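(* Let $f$ be a real-valued symmetric function on $\{1,2,\dots\}^2$, $n\ge 4$ and $i\in\{1,2\}$. Then $n_t(n,i)+1$ equals the number of distinct (possibly isomorphic) polyomino chains with $n$ squares and last link $L_n=i$ whose $TI_f$ value equals $M_f(n,i)$.
   Context: Polyomino chains (restricted model). For $n\ge 2$, a polyomino chain with $n$ squares is a sequence of closed unit squares $S_1,\dots,S_n$ in the plane with $S_1=[0,1]\times[0,1]$, $S_2=[1,2]\times[0,1]$, and for $k\ge 3$, $S_k=S_{k-1}+v_k$, where $v_2=(1,0)$ and each $v_k\in\{(1,0),(0,-1)\}$ satisfies $v_k=v_{k-1}$ if $L_k=1$ and $v_k\neq v_{k-1}$ if $L_k=2$. For $n\ge3$ the chain is determined by its link vector $(L_3,\dots,L_n)\in\{1,2\}^{n-2}$ and denoted $PC(L_3,\dots,L_n)$; two chains are distinct iff their link vectors differ. Each chain is regarded as the graph whose vertices are the corners of the squares and whose edges are the sides of the squares. For a real-valued symmetric $f$ on positive integers, $TI_f(G)=\sum_{uv\in E(G)} f(d_u,d_v)$, with $d_u$ the degree of $u$. $M_f(n,i)$ ($n\ge3$, $i\in\{1,2\}$) is the maximum of $TI_f$ over polyomino chains with $n$ squares and last link $L_n=i$. Define $g_f(1,1)=3f(3,3)$, $g_f(1,2)=3f(3,4)+f(2,4)+f(2,3)-2f(3,3)$, $g_f(2,1)=f(3,4)-f(2,4)+f(2,3)+2f(3,3)$, $g_f(2,2)=f(4,4)+2f(2,4)$. Number of ties $n_t(n,i)$: set $n_t(3,1)=n_t(3,2)=0$;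 for $n\ge4$ and $i\in\{1,2\}$: if for some $j\in\{1,2\}$, $M_f(n-1,j)+g_f(j,i)>M_f(n-1,3-j)+g_f(3-j,i)$, then $n_t(n,i)=n_t(n-1,j)$; if $M_f(n-1,1)+g_f(1,i)=M_f(n-1,2)+g_f(2,i)$, then $n_t(n,i)=1+n_t(n-1,1)+n_t(n-1,2)$. *)

(* Defs.v *)
From HB Require Import structures.
From mathcomp Require Import all_boot all_order all_algebra.
From mathcomp Require Import reals.

Set Implicit Arguments.
Unset Strict Implicit.
Unset Printing Implicit Defensive.

Import Order.TTheory GRing.Theory Num.Theory.
Local Open Scope ring_scope.

(** A link is an element of {1, 2}; [Link1] and [Link2] stand for 1 and 2. *)
Inductive link := Link1 | Link2.

Definition bool_of_link (i : link) : bool := if i is Link2 then true else false.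
Definition link_of_bool (b : bool) : link := if b then Link2 else Link1.

Lemma bool_of_linkK : cancel bool_of_link link_of_bool.
Proof. by case. Qed.

HB.instance Definition _ := Finite.copy link (can_type bool_of_linkK).

Definition point : Type := (int * int)%type.

Definition east : point := (1, 0).
Definition south : point := (0, -1).

(** [next_step v_(k-1) L_k] is the translation vector v_k. *)
Definition next_step (v : point) (l : link) : point :=
  match l with
  | Link1 => v
  | Link2 => if v == east then south else east
  end.

(** The closed unit square [x, x+1] x [y, y+1] is represented by its lower left
    corner (x, y). For L = (L_3, ..., L_n), the translations after v_2 = east
    are [scanl next_step east L] = (v_3, ..., v_n), and [squares L] lists the
    lower left corners of S_1, ..., S_n. *)
Definition squares (L : seq link) : seq point :=
  let v := east :: scanl next_step east L in
  (0, 0) :: scanl (fun p w : point => p + w) (0, 0) v.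

(** A side is stored as its pair of endpoints in increasing coordinate order,
    so that a side shared by two squares has a single representation. *)
Definition sides (p : point) : seq (point * point) :=
  [:: (p, p + (1, 0)); (p, p + (0, 1));
      (p + (0, 1), p + (1, 1)); (p + (1, 0), p + (1, 1))].

(** A simple graph is given by the duplicate-free list of its edges, each listed
    in one orientation; every corner of a square is an endpoint of a side, so
    the edges of a chain determine its vertices. *)
Definition degree (V : eqType) (E : seq (V * V)) (u : V) : nat :=
  count (fun e => (e.1 == u) || (e.2 == u)) E.

Definition TI_graph (R : realType) (V : eqType) (f : nat -> nat -> R)
    (E : seq (V * V)) : R :=
  \sum_(e <- E) f (degree E e.1) (degree E e.2).

Definition PC_edges (L : seq link) : seq (point * point) :=
  undup (flatten [seq sides p | p <- squares L]).

Definition TI (R : realType) (f : nat -> nat -> R) (L : seq link) : R :=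
  TI_graph f (PC_edges L).

(** The link vectors (L_3, ..., L_n) with L_n = i, for n >= 3; the default
    value of [last] is then irrelevant. *)
Definition chains (n : nat) (i : link) : {set (n - 2).-tuple link} :=
  [set L : (n - 2).-tuple link | last Link1 L == i].

(** The constant link vector (i, ..., i), which belongs to [chains n i] when
    n >= 3, only witnesses that the maximum is over a nonempty set. *)
Definition M (R : realType) (f : nat -> nat -> R) (n : nat) (i : link) : R :=
  TI f [arg max_(L > nseq_tuple (n - 2) i in chains n i) TI f L]%O.

Definition g (R : realType) (f : nat -> nat -> R) (j i : link) : R :=
  match j, i with
  | Link1, Link1 => 3 * f 3%N 3%N
  | Link1, Link2 => 3 * f 3%N 4%N + f 2%N 4%N + f 2%N 3%N - 2 * f 3%N 3%N
  | Link2, Link1 => f 3%N 4%N - f 2%N 4%N + f 2%N 3%N + 2 * f 3%N 3%N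
  | Link2, Link2 => f 4%N 4%N + 2 * f 2%N 4%N
  end.

(** The number of ties n_t(n, i); the value 0 for n < 3 is junk. *)
Fixpoint ties (R : realType) (f : nat -> nat -> R) (n : nat) (i : link) : nat :=
  if n is m.+1 then
    if (n <= 3)%N then 0%N
    else if M f m Link1 + g f Link1 i > M f m Link2 + g f Link2 i then
      ties f m Link1
    else if M f m Link2 + g f Link2 i > M f m Link1 + g f Link1 i then
      ties f m Link2
    else (1 + ties f m Link1 + ties f m Link2)%N
  else 0%N.

(* Main.v *)
(** Translations are only east or south, so a new square meets the earlier part
    of the chain in one side of the last square, and appending it changes degrees
    only at the endpoints of that side. These endpoints and their neighbours have
    degrees determined by the last two links, so appending a link [i] after a last
    link [j] raises [TI f] by exactly [g f j i]. Hence the optimal chains ending in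
    [j, i] are exactly the optimal chains ending in [j], followed by [i], provided
    that [M f (n-1) j + g f j i] attains [M f n i]: their number satisfies the
    recursion of [ties f n i + 1]. *)

Require Import Defs.
From mathcomp Require Import all_boot all_order all_algebra.
From mathcomp Require Import zify ring lra.
From mathcomp Require Import reals.

Set Implicit Arguments.
Unset Strict Implicit.
Unset Printing Implicit Defensive.

Import Order.TTheory GRing.Theory Num.Theory.

Local Open Scope ring_scope.

(** * Chains as walks, in coordinates relative to the last square *)

Definition walk (V : seq point) : seq point :=
  0 :: scanl (fun p w : point => p + w) 0 V.

Definition walk_end (V : seq point) : point := foldl (fun p w : point => p + w) 0 V.

Definition walk_edges (V : seq point) : seq (point * point) :=
  undup (flatten [seq sides p | p <- walk V]).

Definition steps (L : seq link) : seq point := east :: scanl next_step east L.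

Lemma PC_edges_steps L : PC_edges L = walk_edges (steps L).
Proof. by []. Qed.

Lemma steps_rcons L i :
  steps (rcons L i) = rcons (steps L) (next_step (foldl next_step east L) i).
Proof. by rewrite /steps scanl_rcons foldl_rcons. Qed.

Lemma walk_rcons V v : walk (rcons V v) = rcons (walk V) (walk_end V + v).
Proof. by rewrite /walk scanl_rcons foldl_rcons. Qed.

Lemma walk_end_rcons V v : walk_end (rcons V v) = walk_end V + v.
Proof. by rewrite /walk_end -cats1 foldl_cat. Qed.

Lemma walk_end_mem V : walk_end V \in walk V.
Proof.
case/lastP: V => [|V v]; first by rewrite inE.
by rewrite walk_rcons walk_end_rcons mem_rcons inE eqxx.
Qed.

Definition shift (p : point) (e : point * point) : point * point :=
  (p + e.1, p + e.2).

Lemma shift_inj p : injective (shift p).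
Proof.
move=> [a b] [c d] /eqP; rewrite xpair_eqE /=.
by case/andP=> /eqP/addrI-> /eqP/addrI->.
Qed.

Lemma shiftD p q e : shift (p + q) e = shift p (shift q e).
Proof. by rewrite /shift /= !addrA. Qed.

(* The sides of the square [p + v] that are not sides of the square [p], in
   coordinates relative to [p]. *)
Definition fresh_sides (v : point) : seq (point * point) :=
  if v == east
  then [:: ((1, 0), (2, 0)); ((1, 1), (2, 1)); ((2, 0), (2, 1))]
  else [:: ((0, -1), (0, 0)); ((1, -1), (1, 0)); ((0, -1), (1, -1))].

(* Relative to the last square, all earlier vertices lie in this quadrant. *)
Definition reachable (u : point) : bool := (u.1 <= 1) && (0 <= u.2).

Definition is_step (v : point) : bool := (v == east) || (v == south).

Lemma degree_cat (V : eqType) (E F : seq (V * V)) u :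
  degree (E ++ F) u = (degree E u + degree F u)%N.
Proof. exact: count_cat. Qed.

Lemma perm_degree (V : eqType) (E F : seq (V * V)) u :
  perm_eq E F -> degree E u = degree F u.
Proof. by move/permP; apply. Qed.

Lemma degree_shift p E u : degree (map (shift p) E) (p + u) = degree E u.
Proof.
rewrite /degree count_map; apply: eq_count => e /=.
by rewrite !(inj_eq (addrI p)).
Qed.

Lemma perm_TI_graph (R : realType) (V : eqType) (f : nat -> nat -> R)
    (E F : seq (V * V)) : perm_eq E F -> TI_graph f E = TI_graph f F.
Proof.
move=> pEF; rewrite /TI_graph (perm_big _ pEF); apply: eq_bigr => e _.
by rewrite !(perm_degree _ pEF).
Qed.

(** * How appended steps change the edge set *)

Definition edges_reachable V :=
  forall e, e \in walk_edges V ->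
    reachable (e.1 - walk_end V) /\ reachable (e.2 - walk_end V).

Definition unit_sides : seq (point * point) :=
  [:: ((0, 0), (1, 0)); ((0, 0), (0, 1)); ((0, 1), (1, 1)); ((1, 0), (1, 1))].

Lemma sides_shift p : sides p = map (shift p) unit_sides.
Proof. by rewrite /sides /= /shift /= addr0. Qed.

(** The two adjacent squares share exactly one side: the right one for a step east, the bottom one
    for a step south. *)
Lemma mem_unit_sides_step v d : is_step v -> d \notin unit_sides ->
  (d \in map (shift v) unit_sides) = (d \in fresh_sides v).
Proof.
case/orP=> /eqP->; rewrite [fresh_sides _]/=.
  have -> : map (shift east) unit_sides =
    [:: ((1, 0), (2, 0)); ((1, 0), (1, 1)); ((1, 1), (2, 1)); ((2, 0), (2, 1))].
    by [].
  rewrite !inE !negb_or => /and4P[_ _ _ /negPf->].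
  by [].
have -> : map (shift south) unit_sides =
  [:: ((0, -1), (1, -1)); ((0, -1), (0, 0)); ((0, 0), (1, 0)); ((1, -1), (1, 0))].
  by [].
rewrite !inE !negb_or => /and4P[/negPf-> _ _ _].
by rewrite /= orbC -!orbA.
Qed.

(** Each fresh side has an endpoint outside the quadrant, so it is not an old edge; the fourth side
    of the new square already belongs to the last square. *)
Lemma walk_edges_rcons V v : is_step v -> edges_reachable V ->
  perm_eq (walk_edges (rcons V v))
          (walk_edges V ++ map (shift (walk_end V)) (fresh_sides v)).
Proof.
move=> vP reachV; apply: uniq_perm; first exact: undup_uniq.
  rewrite cat_uniq undup_uniq (map_inj_uniq (@shift_inj _)) /=.
  apply/andP; split; last by case/orP: vP => /eqP->.
  apply/hasPn => e /mapP[d dv ->]; apply/negP => /reachV[].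
  rewrite /shift /= ![walk_end V + _]addrC !addrK.
  by case/orP: vP dv => /eqP->; rewrite !inE => /or3P[] /eqP->.
move=> e; rewrite mem_undup walk_rcons map_rcons flatten_rcons [RHS]mem_cat mem_undup.
have : {subset sides (walk_end V) <= flatten [seq sides p | p <- walk V]}.
  by move=> d dV; apply/flattenP; exists (sides (walk_end V));
    rewrite ?map_f ?walk_end_mem.
move: (flatten _) => F subF; rewrite mem_cat.
have [//|eF /=] := boolP (e \in F).
have : e \notin sides (walk_end V) by apply: contra eF; apply: subF.
have -> : e = shift (walk_end V) (shift (- walk_end V) e).
  by case: e {eF} => a b; rewrite /shift /= !addrA !subrr !add0r.
rewrite !sides_shift (eq_map (shiftD _ _)) map_comp !(mem_map (@shift_inj _)).
by move=> dV; apply: mem_unit_sides_step.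
Qed.

(** The quadrant attached to the new last square contains the one attached to the old last
    square. *)
Lemma reachableB_step u v : is_step v -> reachable u -> reachable (u - v).
Proof.
case: u => a b; rewrite /reachable.
by case/orP=> /eqP-> /=; lia.
Qed.

Lemma walk_edges_reachable V : all is_step V -> edges_reachable V.
Proof.
elim/last_ind: V => [_ e|V v IH].
  rewrite mem_undup !inE !subr0.
  by case/or4P => /eqP->.
rewrite all_rcons => /andP[vP /IH reachV] e.
rewrite (perm_mem (walk_edges_rcons vP reachV)) mem_cat walk_end_rcons.
case/orP => [/reachV[r1 r2]|/mapP[d dv ->]].
  by rewrite !opprD !addrA; split; apply: reachableB_step.
rewrite /shift /= ![walk_end V + _]addrC !opprD !addrA.
rewrite ![_ - v - _]addrAC !addrK.
by case/orP: vP dv => /eqP->; rewrite !inE => /or3P[] /eqP->.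
Qed.

Lemma degree_unreachable V u : all is_step V -> ~~ reachable u ->
  degree (walk_edges V) (walk_end V + u) = 0%N.
Proof.
move=> /walk_edges_reachable reachV uP; apply/eqP; rewrite -leqn0 leqNgt -has_count.
apply/hasPn => e /reachV[r1 r2]; apply/negP => /orP[] /eqP Ee.
  by move: r1; rewrite Ee addrC addrA addNr add0r (negPf uP).
by move: r2; rewrite Ee addrC addrA addNr add0r (negPf uP).
Qed.

(* Only the last square of a walk contains its lower right corner. *)
Lemma degree_lower_right V : all is_step V ->
  degree (walk_edges V) (walk_end V + (1, 0)) = 2%N.
Proof.
case/lastP: V => [_|V v]; first by [].
rewrite all_rcons => /andP[vP stepV].
rewrite (perm_degree _ (walk_edges_rcons vP (walk_edges_reachable stepV))).
rewrite degree_cat walk_end_rcons -addrA degree_shift.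
by rewrite degree_unreachable //; case/orP: vP => /eqP->.
Qed.

Lemma perm_walk_edges_rcons V E v : is_step v -> all is_step V ->
  perm_eq (walk_edges V) E ->
  perm_eq (walk_edges (rcons V v)) (E ++ map (shift (walk_end V)) (fresh_sides v)).
Proof.
move=> vP stepV pE.
apply: perm_trans (walk_edges_rcons vP (walk_edges_reachable stepV)) _.
by rewrite perm_cat2r.
Qed.

(** Expressing all new edges relative to the end of the prefix [V] makes them explicit lists, so
    that degrees among them can be computed. *)
Lemma walk_edges_rcons2 V v1 v2 : all is_step V -> is_step v1 -> is_step v2 ->
  perm_eq (walk_edges (rcons (rcons V v1) v2))
    (walk_edges V ++ map (shift (walk_end V))
      (fresh_sides v1 ++ map (shift v1) (fresh_sides v2))).
Proof.
move=> stepV v1P v2P; rewrite map_cat catA -map_comp -(eq_map (shiftD _ _)).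
rewrite -walk_end_rcons; apply: perm_walk_edges_rcons => //.
  by rewrite all_rcons v1P.
exact: perm_walk_edges_rcons.
Qed.

Lemma walk_edges_rcons3 V v1 v2 v3 :
  all is_step V -> is_step v1 -> is_step v2 -> is_step v3 ->
  perm_eq (walk_edges (rcons (rcons (rcons V v1) v2) v3))
    (walk_edges V ++ map (shift (walk_end V))
      ((fresh_sides v1 ++ map (shift v1) (fresh_sides v2)) ++
        map (shift (v1 + v2)) (fresh_sides v3))).
Proof.
move=> stepV v1P v2P v3P; rewrite map_cat catA -[X in _ ++ X]map_comp.
rewrite -(eq_map (shiftD _ _)) addrA -!walk_end_rcons.
apply: perm_walk_edges_rcons => //; first by rewrite !all_rcons v1P v2P.
exact: walk_edges_rcons2.
Qed.

(** * The increment of the index when a link is appended *)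

Definition far (e : point * point) : bool :=
  ~~ reachable e.1 && ~~ reachable e.2.

(** Far edges do not touch the vertices of [V], so the terms of the old edges cancel. What remains
    is a sum over explicit edges, in which [V] enters only through the degrees [d]. *)
Lemma TI_graph_extend (R : realType) (f : nat -> nat -> R) V N X
    (d := fun u => degree (walk_edges V) (walk_end V + u))
    (w := fun N e => f (d e.1 + degree N e.1)%N (d e.2 + degree N e.2)%N) :
  all is_step V -> all far X ->
  TI_graph f (walk_edges V ++ map (shift (walk_end V)) (N ++ X)) -
    TI_graph f (walk_edges V ++ map (shift (walk_end V)) N) =
  \sum_(e <- N ++ X) w (N ++ X) e - \sum_(e <- N) w N e.
Proof.
move=> stepV farX.
have wE Y : \sum_(e <- map (shift (walk_end V)) Y)
    f (degree (walk_edges V ++ map (shift (walk_end V)) Y) e.1)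
      (degree (walk_edges V ++ map (shift (walk_end V)) Y) e.2) =
    \sum_(e <- Y) w Y e.
  by rewrite big_map; apply: eq_bigr => e _; rewrite !degree_cat !degree_shift.
have farE u : reachable (u - walk_end V) ->
    degree (map (shift (walk_end V)) X) u = 0%N.
  move=> uP; apply/eqP; rewrite -leqn0 leqNgt -has_count.
  apply/hasPn => _ /mapP[x /(allP farX) /andP[x1 x2] ->] /=.
  apply/negP => /orP[] /eqP xu; move: uP; rewrite -xu addrC addrA addNr add0r.
    by rewrite (negPf x1).
  by rewrite (negPf x2).
rewrite /TI_graph ![\sum_(_ <- walk_edges V ++ _) _]big_cat /= !wE.
rewrite [X in X + _ - _](_ : _ =
  \sum_(e <- walk_edges V)
    f (degree (walk_edges V ++ map (shift (walk_end V)) N) e.1)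
      (degree (walk_edges V ++ map (shift (walk_end V)) N) e.2)); first by ring.
apply: eq_big_seq => e /(walk_edges_reachable stepV)[r1 r2].
by rewrite map_cat catA !(degree_cat (_ ++ _)) !farE ?addn0.
Qed.

Lemma next_step_is_step v i : is_step v -> is_step (next_step v i).
Proof. by case: i => //=; case: ifP. Qed.

Lemma TI_graph_walk_rcons (R : realType) (f : nat -> nat -> R) V v j i :
  (forall a b : nat, (0 < a)%N -> (0 < b)%N -> f a b = f b a) ->
  all is_step V -> is_step v ->
  let v2 := next_step v j in let v3 := next_step v2 i in
  TI_graph f (walk_edges (rcons (rcons (rcons V v) v2) v3)) =
  TI_graph f (walk_edges (rcons (rcons V v) v2)) + g f j i.
Proof.
move=> f_sym stepV vP v2 v3.
have v2P : is_step v2 by apply: next_step_is_step.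
have v3P : is_step v3 by apply: next_step_is_step.
rewrite (perm_TI_graph f (walk_edges_rcons2 stepV vP v2P)).
rewrite (perm_TI_graph f (walk_edges_rcons3 stepV vP v2P v3P)).
apply/eqP; rewrite [eqbRHS]addrC -subr_eq; apply/eqP.
rewrite TI_graph_extend //; last first.
  (* The third square is two steps beyond the first new one, so its fresh sides avoid the quadrant
     of the prefix. *)
  by rewrite /v3 /v2 {v3 v3P v2 v2P}; case/orP: vP => /eqP->; case: j; case: i.
pose c u := degree (walk_edges V) (walk_end V + u).
(* Only the degree of the lower right corner must be known. The other unknown degrees [c u] occur in
   terms common to both sums, which cancel. *)
have degE u : degree (walk_edges V) (walk_end V + u) =
    if u == (1, 0) then 2%N else if reachable u then c u else 0%N.
  have [->|_] := eqVneq u (1, 0); first exact: degree_lower_right.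
  by have [//|/(degree_unreachable stepV)] := boolP (reachable u).
move: c degE => c degE; rewrite /v3 /v2 {v3 v3P v2 v2P}.
(* Edges are oriented by coordinates, so a pair of degrees may occur in either order. *)
have f32 : f 3 2 = f 2 3 by apply: f_sym.
have f42 : f 4 2 = f 2 4 by apply: f_sym.
have f43 : f 4 3 = f 3 4 by apply: f_sym.
case/orP: vP => /eqP->; case: j; case: i;
  rewrite /= !big_cons !big_nil !degE /shift /= !(addSn, add0n);
  rewrite ?f32 ?f42 ?f43; ring.
Qed.

Lemma TI_rcons (R : realType) (f : nat -> nat -> R) L j i :
  (forall a b : nat, (0 < a)%N -> (0 < b)%N -> f a b = f b a) ->
  TI f (rcons (rcons L j) i) = TI f (rcons L j) + g f j i.
Proof.
move=> f_sym; rewrite /TI !PC_edges_steps !steps_rcons foldl_rcons.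
have stepsP : all is_step (steps L).
  elim/last_ind: L => // L l; rewrite steps_rcons all_rcons => ->.
  rewrite andbT; apply: next_step_is_step.
  by elim/last_ind: L => // L' l' IH; rewrite foldl_rcons next_step_is_step.
have lastE : last east (scanl next_step east L) = foldl next_step east L.
  by elim: L east {stepsP} => //= l L IH v.
(* The list of steps is never empty; its last vector is the direction to which [j], then [i], is
   applied. *)
rewrite /steps (lastI east) -lastE in stepsP *.
move: stepsP; rewrite all_rcons => /andP[vP stepV].
exact: TI_graph_walk_rcons.
Qed.

(** * Counting the optimal chains *)

Lemma tuple_rconsE (T : Type) k (L : k.+1.-tuple T) :
  exists (L' : k.-tuple T) (x : T), L = rcons_tuple L' x.
Proof.
case: L => s; case/lastP: s => [//|s x] sz.
have sz' : size s == k by move: sz; rewrite size_rcons eqSS.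
by exists (Tuple sz'), x; apply: val_inj.
Qed.

(** The sets [O j] lie in distinct fibres of [p], and [b] keeps or discards each fibre as a whole.
    Here [p] will be the last link. *)
Lemma card_link_fibers (T : finType) (p : T -> link) (O : link -> {set T})
    (b : pred link) : (forall j x, x \in O j -> p x = j) ->
  #|[set x | (x \in O (p x)) && b (p x)]| =
  (b Link1 * #|O Link1| + b Link2 * #|O Link2|)%N.
Proof.
move=> pO; set S := [set x | _].
have fiberS j : #|S :&: [set x | p x == j]| = (b j * #|O j|)%N.
  have memS x : (x \in S :&: [set x | p x == j]) = (x \in O j) && b j.
    rewrite !inE; have [->|neq] := eqVneq (p x) j; first by rewrite andbT.
    rewrite andbF; apply/esym/negP => /andP[/pO pxj _].
    by rewrite pxj eqxx in neq.
  have [bj|/negPf bj] := boolP (b j); rewrite /= ?mul1n ?mul0n.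
    by apply: eq_card => x; rewrite memS bj andbT.
  by apply: eq_card0 => x; rewrite memS bj andbF.
rewrite -!fiberS -(cardsID [set x | p x == Link1] S); congr addn.
by apply: eq_card => x; rewrite !inE andbC; case: (p x).
Qed.

(** Here [m] is the maximum of [x] and [y]. In a tie both summands survive, and
    [(t1 + 1) + (t2 + 1)] accounts for the extra 1 in the recursion of [ties]. *)
Lemma tie_count (R : realType) (x y m : R) (t1 t2 : nat) :
  x <= m -> y <= m -> x = m \/ y = m ->
  ((x == m) * (t1 + 1) + (y == m) * (t2 + 1))%N =
  ((if (y < x)%R then t1 else if (x < y)%R then t2 else 1 + t1 + t2) + 1)%N.
Proof.
move=> xm ym [xE|yE].
  by rewrite xE eqxx in ym *; case: (ltgtP y m) ym => //= _ _; lia.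
by rewrite yE eqxx in xm *; case: (ltgtP x m) xm => //= _ _; lia.
Qed.

Section Counting.

Variables (R : realType) (f : nat -> nat -> R).
Hypothesis f_sym : forall a b : nat, (0 < a)%N -> (0 < b)%N -> f a b = f b a.

Definition optimal_chains (n : nat) (i : link) : {set (n - 2).-tuple link} :=
  [set L in chains n i | TI f L == M f n i].

Lemma mem_optimal_chains k i (L : k.+1.-tuple link) :
  (L \in optimal_chains k.+3 i) = (last Link1 L == i) && (TI f L == M f k.+3 i).
Proof. by rewrite !inE. Qed.

Lemma M_spec k i :
  (exists2 L : k.+1.-tuple link, last Link1 L = i & TI f L = M f k.+3 i) /\
  (forall L : k.+1.-tuple link, last Link1 L = i -> TI f L <= M f k.+3 i).
Proof.
rewrite /M; case: Order.TotalTheory.arg_maxP => [|L].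
  by rewrite inE; elim: k => //=.
rewrite inE => /eqP lastL maxL; split; first by exists L.
by move=> L' lastL'; apply: maxL; rewrite inE lastL'.
Qed.

Lemma TI_rcons_tuple k i (L : k.+1.-tuple link) :
  TI f (rcons L i) = TI f L + g f (last Link1 L) i.
Proof.
case: L => s sz /=; case/lastP: s sz => [//|s j _] /=.
by rewrite TI_rcons // last_rcons.
Qed.

Lemma M_succ_ge k i j : M f k.+3 j + g f j i <= M f k.+4 i.
Proof.
have [[L lastL <-] _] := M_spec k j; have [_ maxM] := M_spec k.+1 i.
rewrite -lastL -TI_rcons_tuple; apply: (maxM (rcons_tuple L i)).
by rewrite last_rcons.
Qed.

(** With [j] the last link of [L], [TI f L + g f j i <= M f k.+3 j + g f j i <= M f k.+4 i]; the
    outer terms agree exactly when both inequalities are equalities. *)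
Lemma optimal_rcons k i (L : k.+1.-tuple link) :
  (rcons_tuple L i \in optimal_chains k.+4 i) =
  (L \in optimal_chains k.+3 (last Link1 L)) &&
  (M f k.+3 (last Link1 L) + g f (last Link1 L) i == M f k.+4 i).
Proof.
rewrite !mem_optimal_chains /= last_rcons !eqxx /= TI_rcons_tuple.
have [_ /(_ L erefl) leL] := M_spec k (last Link1 L).
have leM := M_succ_ge k i (last Link1 L).
move: (TI _ _) (M _ _ _) (g _ _ _) (M _ _ _) leL leM => t m c m' leL leM.
apply/eqP/andP => [eqM|[/eqP-> /eqP//]].
by split; apply/eqP; lra.
Qed.

Lemma card_optimal_succ k i (b := fun j => M f k.+3 j + g f j i == M f k.+4 i) :
  #|optimal_chains k.+4 i| =
  (b Link1 * #|optimal_chains k.+3 Link1| +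
   b Link2 * #|optimal_chains k.+3 Link2|)%N.
Proof.
pose S := [set L : k.+1.-tuple link |
  (L \in optimal_chains k.+3 (last Link1 L)) && b (last Link1 L)].
(* Deleting the last link, which must be [i], is a bijection onto [S]; the elements of [S] are then
   sorted by their own last link. *)
have -> : optimal_chains k.+4 i = [set rcons_tuple L i | L in S].
  apply/setP => L; apply/idP/imsetP => [LP|[L' + ->]]; last first.
    by rewrite [in X in X -> _]inE optimal_rcons.
  have lastL : last Link1 L = i by move: LP; rewrite mem_optimal_chains => /andP[/eqP].
  have [L' [x LE]] := tuple_rconsE L.
  have {x} {}LE : L = rcons_tuple L' i.
    by rewrite LE; congr rcons_tuple; rewrite -lastL LE last_rcons.
  by exists L' => //; rewrite LE optimal_rcons in LP; rewrite inE.
rewrite card_imset; last first.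
  by move=> L L' /(congr1 val) /rcons_inj[] /val_inj.
apply: card_link_fibers => j L.
by rewrite mem_optimal_chains => /andP[/eqP].
Qed.

Lemma card_optimal k i : #|optimal_chains k.+3 i| = (ties f k.+3 i + 1)%N.
Proof.
elim: k i => [|k IH] i.
  have [[L lastL TIL] _] := M_spec 0 i.
  (* For three squares the link vector is the single entry [i], so there is one chain and no tie. *)
  rewrite (_ : optimal_chains 3 i = [set L]) ?cards1 //; apply/setP => L'.
  have tuple1 (T : 1.-tuple link) : T = [tuple last Link1 T].
    by case: T => -[|x []] // sz; apply: val_inj.
  rewrite mem_optimal_chains in_set1; apply/andP/eqP => [[/eqP lastL' _]|->];
    last by rewrite lastL TIL.
  by rewrite (tuple1 L) (tuple1 L') lastL lastL'.
have le1 := M_succ_ge k i Link1; have le2 := M_succ_ge k i Link2.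
(* If neither candidate attained the maximum, the recursion would count no optimal chain, although
   one exists. *)
have orM : M f k.+3 Link1 + g f Link1 i = M f k.+4 i \/
    M f k.+3 Link2 + g f Link2 i = M f k.+4 i.
  have [[L lastL TIL] _] := M_spec k.+1 i.
  have : (0 < #|optimal_chains k.+4 i|)%N.
    by apply/card_gt0P; exists L; rewrite mem_optimal_chains lastL TIL !eqxx.
  rewrite card_optimal_succ; case: eqP => [E1 _|_]; first by left.
  by case: eqP => [E2 _|//]; right.
apply: etrans (card_optimal_succ k i) _.
apply: etrans (tie_count _ _ le1 le2 orM).
by congr (_ * _ + _ * _)%N; apply: IH.
Qed.

End Counting.

Theorem theorem2 (R : realType) (f : nat -> nat -> R)
    (f_sym : forall a b : nat, (0 < a)%N -> (0 < b)%N -> f a b = f b a)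
    (n : nat) (n_ge4 : (4 <= n)%N) (i : link) :
  (ties f n i + 1)%N = #|[set L in chains n i | TI f L == M f n i]|.
Proof.
case: n n_ge4 => [|[|[|k]]] // _.
by apply/esym; apply: card_optimal.
Qed.
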